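(* Let $d\ge 1$ be an integer and let $Z\in\mathbb{M}_d$. Then there exist unitary matrices $V_1,\ldots,V_d\in\mathbb{M}_d$ such that $$ |Z|_{\mathrm{qsym}}\le \frac{\sqrt{2}}{d}\sum_{i=1}^d V_i|Z|_{\mathrm{sym}}V_i^*. $$ Moreover, the constant $\sqrt{2}$ cannot be diminished: there is no constant $c<\sqrt{2}$ such that, for every $d\ge1$ and every $Z\in\mathbb{M}_d$, there exist unitary matrices $V_1,\ldots,V_d\in\mathbb{M}_d$ with $|Z|_{\mathrm{qsym}}\le \frac{c}{d}\sum_{i=1}^d V_i|Z|_{\mathrm{sym}}V_i^*$.
   Context: $\mathbb{M}_d$ is the space of complex $d\times d$ matrices. For $Z\in\mathbb{M}_d$, $|Z|=(Z^*Z)^{1/2}$, so $|Z^*|=(ZZ^* )^{1/2}$. The symmetric modulus and the quadratic symmetric modulus of $Z$ are $$ |Z|_{\mathrm{sym}}=\frac{|Z|+|Z^*|}{2},\qquad |Z|_{\mathrm{qsym}}=\sqrt{\frac{|Z|^2+|Z^*|^2}{2}}. $$ The inequality $X\le Y$ between Hermitian matrices is the usual (Loewner) order: $Y-X$ is positive semidefinite. *)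

(* Defs.v *)
From HB Require Import structures.
From mathcomp Require Export all_boot all_order all_algebra.
From mathcomp Require Export sesquilinear spectral.
From mathcomp Require Export complex.
From mathcomp Require Export reals.

Set Implicit Arguments.
Unset Strict Implicit.
Unset Printing Implicit Defensive.

Import Order.TTheory GRing.Theory Num.Theory.
Local Open Scope ring_scope.
Local Open Scope sesquilinear_scope.

Section MatrixModuli.
Variables (C : numClosedFieldType) (d : nat).
Implicit Types A B Z : 'M[C]_d.

Definition psdmx A : Prop :=
  A \is hermsymmx /\ forall u : 'cV[C]_d, 0 <= (u^t* *m A *m u) 0 0.

Definition loewner_le A B : Prop := psdmx (B - A).

(* Functional calculus at the square root: when A = U^* D U with U
   unitary and D diagonal, this is U^* D^(1/2) U. It is only meaningful for
   positive semidefinite A; see psdmx_sqrtmx, sqrtmxK and sqrtmx_unique. *)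
Definition sqrtmx A : 'M[C]_d :=
  (spectralmx A)^t* *m diag_mx (map_mx sqrtC (spectral_diag A))
    *m spectralmx A.

Definition absmx Z : 'M[C]_d := sqrtmx (Z^t* *m Z).

Definition symabsmx Z : 'M[C]_d := 2^-1 *: (absmx Z + absmx (Z^t*)).

Definition qsymabsmx Z : 'M[C]_d :=
  sqrtmx (2^-1 *: (absmx Z ^+ 2 + absmx (Z^t*) ^+ 2)).

Lemma hermsymmxP A : reflect (A^t* = A) (A \is hermsymmx).
Proof.
rewrite qualifE /= expr0 scale1r eq_sym; exact: eqP.
Qed.

Lemma trmxC_mul m n p (A : 'M[C]_(m, n)) (B : 'M[C]_(n, p)) :
  (A *m B)^t* = B^t* *m A^t*.
Proof. by rewrite trmx_mul map_mxM. Qed.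

Lemma form_diag (D : 'rV[C]_d) (u : 'cV[C]_d) :
  (u^t* *m diag_mx D *m u) 0 0 = \sum_i D 0 i * `|u i 0| ^+ 2.
Proof.
rewrite mul_mx_diag mxE; apply: eq_bigr => i _; rewrite !mxE.
by rewrite normCKC mulrAC mulrC.
Qed.

Lemma psdmx_conj A B : psdmx A -> psdmx (B^t* *m A *m B).
Proof.
move=> [/hermsymmxP hA pA]; split=> [|u].
  by apply/hermsymmxP; rewrite !trmxC_mul trmxCK hA mulmxA.
by have := pA (B *m u); rewrite trmxC_mul !mulmxA.
Qed.

Lemma psdmx_diag (D : 'rV[C]_d) : (forall i, 0 <= D 0 i) -> psdmx (diag_mx D).
Proof.
move=> D0; split=> [|u].
  apply/hermsymmxP; rewrite tr_diag_mx map_diag_mx; congr diag_mx.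
  by apply/rowP=> i; rewrite !mxE; apply/CrealP; rewrite ger0_real.
by rewrite form_diag sumr_ge0 // => i _; rewrite mulr_ge0 // exprn_ge0.
Qed.

Lemma psdmx_spectral A : psdmx A ->
  A = (spectralmx A)^t* *m diag_mx (spectral_diag A) *m spectralmx A.
Proof.
move=> [hA _]; have /orthomx_spectralP := hermitian_normalmx hA.
by rewrite invmx_unitary ?spectral_unitarymx.
Qed.

Lemma spectral_diag_ge0 A i : psdmx A -> 0 <= spectral_diag A 0 i.
Proof.
move=> psdA; have := psdmx_conj ((spectralmx A)^t*) psdA; rewrite trmxCK.
have /unitarymxP UU := spectral_unitarymx A.
have -> : spectralmx A *m A *m (spectralmx A)^t* = diag_mx (spectral_diag A).
  rewrite {2}(psdmx_spectral psdA) !mulmxA UU mul1mx.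
  by rewrite -mulmxA UU mulmx1.
move=> [_ /(_ (delta_mx i 0))]; rewrite form_diag (bigD1 i) //= big1.
  by rewrite mxE !eqxx normr1 expr1n mulr1 addr0.
by move=> j ji; rewrite mxE (negPf ji) normr0 expr0n mulr0.
Qed.

Lemma psdmx_sqrtmx A : psdmx A -> psdmx (sqrtmx A).
Proof.
move=> psdA; apply/psdmx_conj/psdmx_diag => i.
by rewrite mxE sqrtC_ge0 spectral_diag_ge0.
Qed.

Lemma sqrtmxK A : psdmx A -> sqrtmx A ^+ 2 = A.
Proof.
move=> psdA; rewrite [RHS](psdmx_spectral psdA) expr2 -[_ * _]/(_ *m _).
rewrite /sqrtmx !mulmxA; congr (_ *m _).
rewrite -[X in X *m diag_mx _]mulmxA; have /unitarymxP -> := spectral_unitarymx A.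
rewrite mulmx1 -mulmxA mulmx_diag; congr (_ *m diag_mx _).
by apply/rowP=> i; rewrite !mxE -expr2 sqrtCK.
Qed.

Lemma psdmx_gram Z : psdmx (Z^t* *m Z).
Proof.
have -> : Z^t* *m Z = Z^t* *m diag_mx (const_mx 1) *m Z.
  by rewrite diag_const_mx mulmx1.
by apply/psdmx_conj/psdmx_diag => i; rewrite mxE.
Qed.

Lemma psdmx_comm_diag_sqrt (D E : 'rV[C]_d) B :
  (forall i, 0 <= D 0 i) -> (forall i, 0 <= E 0 i) ->
  B *m diag_mx (map_mx (fun x => x ^+ 2) D) =
    diag_mx (map_mx (fun x => x ^+ 2) E) *m B ->
  B *m diag_mx D = diag_mx E *m B.
Proof.
move=> D0 E0 /matrixP eB; apply/matrixP=> i j; move: (eB i j).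
rewrite !(mul_mx_diag, mul_diag_mx) !mxE [RHS]mulrC => /eqP.
rewrite [X in _ == X]mulrC [X in _ == X]mulrC -subr_eq0 => e.
apply/eqP; rewrite -subr_eq0; move: e.
rewrite [_ * B i j]mulrC -!mulrBr !mulf_eq0; case: (B i j == 0) => //=.
by rewrite !subr_eq0 eqrXn2.
Qed.

Lemma sqrtmx_unique A B : psdmx B -> B ^+ 2 = A -> sqrtmx A = B.
Proof.
move=> psdB BA; have psdA : psdmx A.
  have [/hermsymmxP hB _] := psdB; have := psdmx_gram B.
  by rewrite hB -BA expr2.
have psdS := psdmx_sqrtmx psdA.
pose U := spectralmx B; pose W := spectralmx (sqrtmx A).
have WW : W *m W^t* = 1%:M by apply/unitarymxP/spectral_unitarymx.
have UU : U *m U^t* = 1%:M by apply/unitarymxP/spectral_unitarymx.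
have sq (X : 'M[C]_d) : psdmx X -> X *m X = (spectralmx X)^t* *m
    diag_mx (map_mx (fun x => x ^+ 2) (spectral_diag X)) *m spectralmx X.
  move=> psdX; have /unitarymxP XX := spectral_unitarymx X.
  rewrite {1 2}(psdmx_spectral psdX) !mulmxA; congr (_ *m _).
  rewrite -[X in X *m diag_mx _]mulmxA XX mulmx1 -mulmxA mulmx_diag.
  by congr (_ *m diag_mx _); apply/rowP=> i; rewrite !mxE expr2.
have eSB : sqrtmx A *m sqrtmx A = B *m B.
  by rewrite -[LHS]/(sqrtmx A * sqrtmx A) -[RHS]/(B * B) -!expr2 sqrtmxK.
have e : W *m U^t* *m diag_mx (spectral_diag B) =
    diag_mx (spectral_diag (sqrtmx A)) *m (W *m U^t*).
  apply: psdmx_comm_diag_sqrt; try by move=> i; exact: spectral_diag_ge0.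
  have := congr1 (fun X => W *m X *m U^t*) eSB.
  rewrite (sq _ psdS) (sq _ psdB) -/U -/W !mulmxA WW mul1mx => ->.
  by rewrite -[LHS]mulmx1 -UU !mulmxA -!mulmxA UU.
have := congr1 (fun X => W^t* *m X *m U) e; rewrite !mulmxA.
rewrite (mulmx1C WW) mul1mx -[in RHS]mulmxA (mulmx1C UU) mulmx1.
by rewrite -(psdmx_spectral psdB) -(psdmx_spectral psdS).
Qed.

End MatrixModuli.

(* Main.v *)
Require Import Defs.
From mathcomp Require Import ring.
From mathcomp Require Import cyclic cyclotomic separable.

(* Let [A = |Z|], [B = |Z^*|] and [X = (A^2 + B^2)^(1/2)], so that the claim is
   that [X] is at most an average of [d] unitary conjugates of [A + B]. Since
   [A^2 <= X^2] gives [A <= X], we have [A >= A X^+ A], and likewise for [B]. In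
   an eigenbasis of [X], with eigenvalues [x_i], this bounds the sum of the
   diagonal entries of [A + B] over any level set [x_i >= x_k] from below by the
   sum of the [x_i], because [A^2 + B^2 = X^2]. Plane rotations then move
   diagonal mass of [A + B] until each diagonal entry is at least [x_i], and
   averaging over the conjugations by the powers of [diag(1, z, ..., z^(d-1))],
   with [z] a primitive d-th root of unity, kills the off-diagonal part. *)

Set Implicit Arguments.
Unset Strict Implicit.
Unset Printing Implicit Defensive.

Import Order.TTheory GRing.Theory Num.Theory.
Local Open Scope ring_scope.
Local Open Scope sesquilinear_scope.

(** * Positive semidefinite matrices, and sums of diagonal entries over level sets *)

Section PsdMatrices.
Variables (C : numClosedFieldType) (d : nat).
Implicit Types (A B X M W : 'M[C]_d) (x : 'rV[C]_d).

Lemma psdmxD A B : psdmx A -> psdmx B -> psdmx (A + B).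
Proof.
move=> [/hermsymmxP hA pA] [/hermsymmxP hB pB]; split=> [|u].
  by apply/hermsymmxP; rewrite linearD /= map_mxD hA hB.
by rewrite mulmxDr mulmxDl mxE addr_ge0.
Qed.

Lemma psdmxZ (a : C) A : 0 <= a -> psdmx A -> psdmx (a *: A).
Proof.
move=> a0 [/hermsymmxP hA pA]; split=> [|u].
  by apply/hermsymmxP; rewrite linearZ /= map_mxZ hA /= geC0_conj.
by rewrite -scalemxAr -scalemxAl mxE mulr_ge0.
Qed.

Lemma herm_entry A i j : A \is hermsymmx -> A j i = (A i j)^*.
Proof. by move=> /hermsymmxP hA; rewrite -[A in LHS]hA !mxE. Qed.

Lemma herm_diag_real A i : A \is hermsymmx -> A i i \is Num.real.
Proof. by move=> hA; apply/CrealP; rewrite -herm_entry. Qed.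

Lemma psdmx_diag_ge0 A i : psdmx A -> 0 <= A i i.
Proof.
move=> [_ /(_ (delta_mx i 0))].
by rewrite trmx_delta map_delta_mx -rowE -colE !mxE.
Qed.

Lemma psdmx_conjC A W : psdmx A -> psdmx (W *m A *m W^t*).
Proof. by move=> /(psdmx_conj (W^t*)); rewrite trmxCK. Qed.

Lemma herm_conjC A W : A \is hermsymmx -> W *m A *m W^t* \is hermsymmx.
Proof.
by move=> /hermsymmxP hA; apply/hermsymmxP; rewrite !trmxC_mul trmxCK hA mulmxA.
Qed.

Lemma unitarymxC W : W \is unitarymx -> W^t* *m W = 1%:M.
Proof. by move=> /unitarymxP /mulmx1C. Qed.

Lemma herm_spectral A : A \is hermsymmx ->
  spectralmx A *m A *m (spectralmx A)^t* = diag_mx (spectral_diag A).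
Proof.
move=> hA; have /orthomx_spectralP := hermitian_normalmx hA.
have U := spectral_unitarymx A.
rewrite invmx_unitary // => {2}->; rewrite !mulmxA (unitarymxP U) mul1mx.
by rewrite -mulmxA (unitarymxP U) mulmx1.
Qed.

Lemma psdmx_unitary_conj A W :
  W \is unitarymx -> psdmx (W *m A *m W^t*) -> psdmx A.
Proof.
move=> U /(psdmx_conj W); rewrite !mulmxA (unitarymxC U) mul1mx.
by rewrite -mulmxA (unitarymxC U) mulmx1.
Qed.

(* Diagonalize [B - A] as [diag m]: the i-th diagonal entry of [B^2 - A^2] is
   then [m_i (2 B_ii - m_i)], and it cannot be nonnegative if [m_i < 0]. *)
Lemma loewner_le_sqrt A B : psdmx A -> psdmx B ->
  loewner_le (A *m A) (B *m B) -> loewner_le A B.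
Proof.
move=> pA pB leAB; have hM : B - A \is hermsymmx.
  case: pA pB => /hermsymmxP hA _ [/hermsymmxP hB _].
  by apply/hermsymmxP; rewrite linearB /= map_mxB hA hB.
have U := spectral_unitarymx (B - A); have eM := herm_spectral hM.
set W := spectralmx _ in U eM; set m := spectral_diag _ in eM.
apply: (psdmx_unitary_conj U); rewrite eM; apply: psdmx_diag => i.
have mR : m 0 i \is Num.real.
  suff -> : m 0 i = (W *m (B - A) *m W^t*) i i.
    exact/herm_diag_real/herm_conjC.
  by rewrite eM mxE eqxx.
have Bi0 := psdmx_diag_ge0 i (psdmx_conjC W pB).
have := psdmx_diag_ge0 i (psdmx_conjC W leAB).
set B' := W *m B *m W^t* in Bi0 *; set A' := W *m A *m W^t*.
have sq X : W *m (X *m X) *m W^t* = (W *m X *m W^t*) *m (W *m X *m W^t*).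
  by rewrite !mulmxA -[W *m X *m _ *m W]mulmxA (unitarymxC U) mulmx1.
rewrite mulmxBr mulmxBl !sq -/B' -/A'.
have -> : A' = B' - diag_mx m by rewrite -eM mulmxBr mulmxBl subKr.
move: Bi0; move: {A'} (B') => {}B' Bi0.
rewrite mulmxBl !mulmxBr mul_diag_mx mul_mx_diag mulmx_diag !mxE eqxx mulr1n.
have -> : forall a b c : C, a - (a - b * c - (c * b - c * c)) = c * (2 * b - c).
  by move=> a b c; ring.
case: (real_ge0P mR) => // m0; rewrite nmulr_rge0 // subr_le0 => le_m.
by have := le_lt_trans le_m m0; rewrite pmulr_rlt0 // le_gtF.
Qed.

(* [A - A X^+ A] is the sum of [K^* A K] for [K = 1 - X^+ A] and
   [(X^+ A)^* (X - A) (X^+ A)], where [X^+] is the pseudo-inverse. *)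
Lemma psdmx_diag_le_row A x i : psdmx A -> (forall l, 0 <= x 0 l) ->
  loewner_le A (diag_mx x) ->
  \sum_l `|A i l| ^+ 2 * (x 0 l)^-1 <= A i i.
Proof.
move=> pA x0 leA; pose D := diag_mx (map_mx (fun a => a^-1) x).
have hA := pA.1; have /hermsymmxP eA := hA.
have hD : D^t* = D.
  have /psdmx_diag[/hermsymmxP //] : forall l, 0 <= map_mx (fun a => a^-1) x 0 l.
  by move=> l; rewrite mxE invr_ge0.
have DXD : D *m diag_mx x *m D = D.
  rewrite !mulmx_diag; congr diag_mx; apply/rowP=> l; rewrite !mxE.
  (* Since [0^-1 = 0], the identity also holds where [x] vanishes, so [D] is a pseudo-inverse even
     for singular [diag_mx x]. *)
  have [->|xl] := eqVneq (x 0 l) 0; first by rewrite invr0 mul0r mulr0.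
  by rewrite mulVf // mul1r.
have := psdmxD (psdmx_conj (1%:M - D *m A) pA) (psdmx_conj (D *m A) leA).
rewrite [(_ - _)^T]linearB /= map_mxB trmxC_mul eA hD trmx1 map_mx1.
have -> : (1%:M - A *m D) *m A *m (1%:M - D *m A) +
    A *m D *m (diag_mx x - A) *m (D *m A) = A - A *m D *m A.
  rewrite mulmxBl mulmxBr mulmxBr mulmxBl !mulmxBl !mul1mx !mulmx1.
  rewrite !mulmxA -[A *m D *m diag_mx x]mulmxA -[A *m (_ *m _) *m _]mulmxA DXD.
  apply/matrixP=> a b; rewrite !mxE; ring.
move/(psdmx_diag_ge0 i); rewrite mul_mx_diag 2!mxE subr_ge0 mxE.
rewrite (eq_bigr (fun l => `|A i l| ^+ 2 * (x 0 l)^-1)) // => l _.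
by rewrite !mxE (herm_entry i l hA) normCK mulrAC.
Qed.

Lemma herm_sqr_diag A i : A \is hermsymmx ->
  (A *m A) i i = \sum_l `|A i l| ^+ 2.
Proof.
move=> hA; rewrite mxE; apply: eq_bigr => l _.
by rewrite (herm_entry i l hA) normCK.
Qed.

(* For [i, l] both in the level set, [x_l^-1] may be replaced by [x_i^-1] since
   [|A_il|] is symmetric; for [l] outside it, [x_l < x_i]. *)
Lemma level_set_sqr A x k : psdmx A -> (forall l, 0 <= x 0 l) ->
  loewner_le (A *m A) (diag_mx x *m diag_mx x) ->
  \sum_(i | x 0 k <= x 0 i) (A *m A) i i * (x 0 i)^-1
    <= \sum_(i | x 0 k <= x 0 i) A i i.
Proof.
move=> pA x0 leA; have hA := pA.1.
have leAx := loewner_le_sqrt pA (psdmx_diag x0) leA.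
pose S := [pred i | x 0 k <= x 0 i].
apply: le_trans (ler_sum _ (fun i (_ : S i) => psdmx_diag_le_row i pA x0 leAx)).
rewrite (eq_bigr (fun i => \sum_(l | S l) `|A i l| ^+ 2 * (x 0 i)^-1 +
    \sum_(l | ~~ S l) `|A i l| ^+ 2 * (x 0 i)^-1)); last first.
  by move=> i _; rewrite herm_sqr_diag // mulr_suml (bigID S).
rewrite [leRHS](eq_bigr (fun i => \sum_(l | S l) `|A i l| ^+ 2 * (x 0 l)^-1 +
    \sum_(l | ~~ S l) `|A i l| ^+ 2 * (x 0 l)^-1)); last first.
  by move=> i _; rewrite (bigID S).
rewrite !big_split lerD //=.
  rewrite exchange_big /= le_eqVlt; apply/orP; left; apply/eqP.
  apply: eq_bigr => l Sl; apply: eq_bigr => i Si.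
  by rewrite (herm_entry i l hA) norm_conjC.
apply: ler_sum => i /= Si; apply: ler_sum => l Sl.
(* If [x_l = 0], then [x_l^-1] defaults to 0 and monotonicity of the inverse fails. But the [l]-th
   diagonal entry of [A^2], the sum of all [|A_lj|^2], is at most [x_l^2 = 0], so row [l] of [A]
   vanishes. *)
have [xl0|xl0] := eqVneq (x 0 l) 0.
  suff -> : A i l = 0 by rewrite normr0 expr0n !mul0r.
  have := psdmx_diag_ge0 l leA; rewrite !mxE.
  rewrite big1 ?sub0r ?oppr_ge0 => [|j _]; last first.
    by rewrite !mxE; case: eqVneq => [<-|_]; rewrite ?xl0 ?mulr0n ?mul0r.
  under eq_bigr do rewrite (herm_entry l _ hA) -normCK.
  rewrite (bigD1 i) //=; set T := \sum_(j | _) _ => le0.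
  have T0 : 0 <= T by apply: sumr_ge0 => j _; rewrite exprn_ge0.
  have := le_trans (ler_wpDr T0 (lexx _)) le0.
  rewrite real_exprn_even_le0 ?normr_real //= normr_eq0 (herm_entry l i hA) => /eqP->.
  by rewrite conjC0.
have x_real j : x 0 j \is Num.real by rewrite ger0_real.
have lt_xl : x 0 l < x 0 k by rewrite real_ltNge.
rewrite ler_wpM2l ?exprn_ge0 // lef_pV2 ?posrE ?lt0r ?x0 ?xl0 //.
  exact: (le_trans (ltW lt_xl)).
rewrite andbT; apply: contraTneq Si => ->.
by rewrite -real_ltNge ?real0 // (le_lt_trans (x0 l)).
Qed.

(* Sums over level sets suffice for the weak majorization of [x] by the
   diagonal of [A + B], and make sorting unnecessary. *)
Lemma level_set_sqrD A B x k :
  psdmx A -> psdmx B -> (forall l, 0 <= x 0 l) ->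
  A *m A + B *m B = diag_mx x *m diag_mx x ->
  \sum_(i | x 0 k <= x 0 i) x 0 i <= \sum_(i | x 0 k <= x 0 i) (A + B) i i.
Proof.
move=> pA pB x0 eAB.
have psd_sq M : psdmx M -> psdmx (M *m M).
  by case=> /hermsymmxP hM _; rewrite -{1}hM; exact: psdmx_gram.
have leA : loewner_le (A *m A) (diag_mx x *m diag_mx x).
  by rewrite /loewner_le -eAB addrC addKr; exact: psd_sq.
have leB : loewner_le (B *m B) (diag_mx x *m diag_mx x).
  by rewrite /loewner_le -eAB addrK; exact: psd_sq.
under [leRHS]eq_bigr do rewrite mxE.
rewrite big_split; apply: le_trans (lerD (level_set_sqr k pA x0 leA)
  (level_set_sqr k pB x0 leB)).
rewrite -big_split /= le_eqVlt; apply/orP; left; apply/eqP/eq_bigr => i _.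
rewrite -mulrDl; have -> : (A *m A) i i + (B *m B) i i = x 0 i * x 0 i.
  by move/matrixP/(_ i i): eAB; rewrite [LHS]mxE mulmx_diag [RHS]mxE eqxx [RHS]mxE.
have [->|xi] := eqVneq (x 0 i) 0; first by rewrite !mul0r.
by rewrite mulfK.
Qed.

End PsdMatrices.

(** * Raising diagonal entries to given targets by plane rotations *)

Section SchurHorn.
Variables (C : numClosedFieldType) (d : nat).
Implicit Types (Y W : 'M[C]_d).

(** Gives the entries of [W Y W^*] when each row of [W] is a combination of two basis vectors, as
    for a plane rotation. *)
Lemma form_row2 Y (a b a' b' : C) (i j i' j' : 'I_d) :
  ((a *: 'e_i + b *: 'e_j : 'rV[C]_d) *m Y *m
    (a' *: 'e_i' + b' *: 'e_j' : 'rV[C]_d)^t*) 0 0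
    = a * a'^* * Y i i' + b * b'^* * Y j j'
      + (a * b'^* * Y i j' + b * a'^* * Y j i').
Proof.
rewrite [(_ + _)^T]linearD map_mxD !linearZ /= !map_mxZ !trmx_delta !map_delta_mx.
rewrite mulmxDl -!scalemxAl -!rowE mulmxDr -!scalemxAr !mulmxDl -!scalemxAl.
by rewrite -!colE !mxE; ring.
Qed.

(** A suitable phase turns [z] into the purely imaginary ['i * |z|]. This is what cancels the cross
    terms of a rotation on the diagonal. *)
Lemma phase_imag (z : C) : exists2 u : C, `|u| = 1 & u * z + u^* * z^* = 0.
Proof.
have [->|z0] := eqVneq z 0.
  by exists 1; rewrite ?normr1 // conjC0 !mulr0 addr0.
have zn : `|z| != 0 by rewrite normr_eq0.
exists ('i * (z^* / `|z|)).
  by rewrite normrM normCi mul1r normf_div norm_conjC normr_id divff.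
rewrite -rmorphM; have -> : 'i * (z^* / `|z|) * z = 'i * `|z|.
  have -> : 'i * (z^* / `|z|) * z = 'i * ((z^* * z) / `|z|) by ring.
  by rewrite -normCKC expr2 mulfK.
by rewrite rmorphM /= conjCi conj_normC mulNr subrr.
Qed.

(** Once the phase cancels the cross terms, a rotation in the plane of [e_i] and [e_j] replaces the
    two diagonal entries by convex combinations with weights [1 - p] and [p], so any amount up to
    their gap can be moved. *)
Lemma rotate_diag Y (i j : 'I_d) (e : C) : Y \is hermsymmx -> i != j ->
  0 <= e -> e <= Y j j - Y i i ->
  exists2 W, W \is unitarymx & forall k, (W *m Y *m W^t*) k k =
    if k == i then Y i i + e else if k == j then Y j j - e else Y k k.
Proof.
move=> hY nij e0; set g := Y j j - Y i i => eg; have ge0 := le_trans e0 eg.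
(* [p] is the squared sine of the angle. If [g = 0], then [e = 0] as well and the default [p = 0] is
   the right value. *)
pose p := e / g; have pg : p * g = e.
  rewrite /p; have [g0|g0] := eqVneq g 0; last by rewrite divfK.
  by rewrite g0 mulr0; apply/eqP; rewrite eq_le e0 -g0 eg.
have p0 : 0 <= p by rewrite divr_ge0.
have p1 : 0 <= 1 - p.
  rewrite subr_ge0 /p; have [->|g0] := eqVneq g 0; first by rewrite invr0 mulr0.
  by rewrite ler_pdivrMr ?mul1r // lt0r g0.
have [u u1 uY] := phase_imag (Y i j).
pose s := sqrtC p * u; pose c := sqrtC (1 - p).
have cc : c^* = c by rewrite geC0_conj // sqrtC_ge0.
have c2 : c * c = 1 - p by rewrite -expr2 sqrtCK.
have s2 : s * s^* = p.
  by rewrite -normCK normrM u1 mulr1 ger0_norm ?sqrtC_ge0 // sqrtCK.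
have sY : s * Y i j + s^* * Y j i = 0.
  have -> : s * Y i j + s^* * Y j i = sqrtC p * (u * Y i j + u^* * (Y i j)^*).
    rewrite /s rmorphM /= (geC0_conj (x := sqrtC p)) ?sqrtC_ge0 //.
    by rewrite (herm_entry i j hY); ring.
  by rewrite uY mulr0.
(* [t] swaps [i] and [j]. Row [i] of [W] is [c e_i - s^* e_j], row [j] is [c e_j + s e_i], and the
   other rows are those of the identity. *)
pose al k := if (k == i) || (k == j) then c else 1.
pose be k := if k == i then - s^* else if k == j then s else 0.
pose t k := if k == i then j else if k == j then i else k.
pose W : 'M[C]_d := \matrix_k (al k *: 'e_k + be k *: 'e_(t k)).
have WE M k l : (W *m M *m W^t*) k l = al k * (al l)^* * M k l
    + be k * (be l)^* * M (t k) (t l)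
    + (al k * (be l)^* * M k (t l) + be k * (al l)^* * M (t k) l).
  rewrite -form_row2 -!(rowK (fun k => al k *: 'e_k + be k *: 'e_(t k))) -/W.
  by rewrite -row_mul !mxE; apply: eq_bigr => m _; rewrite !mxE.
have nji : (j == i) = false by rewrite eq_sym (negPf nij).
exists W => [|k]; last first.
  rewrite WE /al /be /t; have [->|ki] := eqVneq k i.
    rewrite /= rmorphN /= conjCK cc -[RHS]subr0 -(mulr0 c) -sY -pg.
    transitivity ((c * c) * Y i i + (s * s^*) * Y j j
      - c * (s * Y i j + s^* * Y j i)); first by ring.
    by rewrite c2 s2 /g; ring.
  have [->|kj] := eqVneq k j.
    rewrite ?orbT /= cc -[RHS]addr0 -(mulr0 c) -sY -pg.
    transitivity ((c * c) * Y j j + (s * s^*) * Y i i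
      + c * (s * Y i j + s^* * Y j i)); first by ring.
    by rewrite c2 s2 /g; ring.
  by rewrite /= conjC0 conjC1 !(mulr0, mul0r, mul1r, addr0).
have cs : c * c + s * s^* = 1 by rewrite c2 s2 subrK.
(* Unitarity is the entry formula [WE] at the identity matrix. *)
apply/unitarymxP/matrixP => k l; rewrite -[W in W *m _]mulmx1 WE /al /be /t !mxE.
have [kE|ki] := eqVneq k i; last have [kE|kj] := eqVneq k j;
  (have [lE|li] := eqVneq l i; last have [lE|lj] := eqVneq l j);
  try rewrite ?kE; try rewrite ?lE; rewrite ?eqxx ?nji ?(negPf nij);
  try rewrite ?(eq_sym i k) ?(negPf ki); try rewrite ?(eq_sym j k) ?(negPf kj);
  try rewrite ?(eq_sym i l) ?(negPf li); try rewrite ?(eq_sym j l) ?(negPf lj);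
  rewrite /= ?rmorphN /= ?conjCK ?conjC0 ?conjC1 ?cc;
  by [ring | rewrite -[RHS]cs; ring].
Qed.

(* An entry below its target with maximal target [x i] is fed, by a rotation,
   from an entry [j] of its level set that exceeds its target; each step makes
   one more entry meet its target exactly. *)
Lemma schur_horn_ge Y (x : 'rV[C]_d) :
  Y \is hermsymmx -> (forall i, x 0 i \is Num.real) ->
  (forall k,
     \sum_(i | x 0 k <= x 0 i) x 0 i <= \sum_(i | x 0 k <= x 0 i) Y i i) ->
  exists2 W, W \is unitarymx & forall i, x 0 i <= (W *m Y *m W^t*) i i.
Proof.
move=> hY xR; have [n] := ubnP #|[set i | Y i i != x 0 i]|.
elim: n => // n IHn in Y hY *; rewrite ltnS => len lexY.
have YR i : Y i i \is Num.real := herm_diag_real i hY.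
case: (pickP (fun i => Y i i < x 0 i)) => [i0 Yi0|leY]; last first.
  exists 1%:M => [|i]; first by apply/unitarymxP; rewrite trmx1 map_mx1 mulmx1.
  by rewrite trmx1 map_mx1 mulmx1 mul1mx real_leNgt // leY.
pose P := [pred i | Y i i < x 0 i]; have Pi0 : P i0 := Yi0.
have [|i /= Yi maxi] := comparable_arg_maxP (F := x 0) Pi0.
  by move=> a b _ _; exact: real_comparable.
(* Otherwise no entry of the level set of [x_i] exceeds its target while entry [i] is strictly
   below, against the hypothesis at [k = i]. *)
have [j xij xYj] : exists2 j, x 0 i <= x 0 j & x 0 j < Y j j.
  case: (pickP (fun j => (x 0 i <= x 0 j) && (x 0 j < Y j j))).
    by move=> j /andP[]; exists j.
  move=> leYx; have := lexY i; rewrite (bigD1 i) //= [leRHS](bigD1 i) //=.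
  rewrite lt_geF // ltr_leD // ler_sum // => l /andP[xil _].
  by have /negbT := leYx l; rewrite xil /= -real_leNgt.
have nij : i != j.
  by apply: contraTneq xYj => <-; rewrite -real_leNgt // ltW.
(* The smaller of the surplus at [j] and the deficit at [i]: neither entry overshoots and one of
   them meets its target. *)
pose e := if Y j j - x 0 j <= x 0 i - Y i i then Y j j - x 0 j else x 0 i - Y i i.
have e1 : e <= x 0 i - Y i i.
  by rewrite /e; case: ifP.
have e2 : e <= Y j j - x 0 j.
  rewrite /e; case: ifP => // /negbT; rewrite -real_ltNge ?rpredB //; exact: ltW.
have e0 : 0 <= e by rewrite /e; case: ifP => _; rewrite subr_ge0 ltW.
have eg : e <= Y j j - Y i i.
  by apply: le_trans e2 _; rewrite lerB // (le_trans _ xij) // ltW.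
have [W1 U1 DY] := rotate_diag hY nij e0 eg.
pose Y1 := W1 *m Y *m W1^t*; have hY1 : Y1 \is hermsymmx by exact: herm_conjC.
have [||W2 U2 leW] := IHn Y1 hY1.
- apply: leq_trans len; apply: proper_card; apply/properP; split.
    apply/subsetP=> k; rewrite !inE DY; have [->|ki] := eqVneq k i.
      by rewrite (lt_eqF Yi).
    by have [->|//] := eqVneq k j; rewrite (gt_eqF xYj).
  rewrite /e in DY; move: DY; case: ifP => _ DY; [exists j | exists i];
    rewrite ?inE ?DY ?(lt_eqF Yi) ?(gt_eqF xYj) ?eqxx //.
    by rewrite (eq_sym j i) (negPf nij) subKr eqxx.
  by rewrite addrC subrK eqxx.
(* If [x_k <= x_i], the level set contains both [i] and [j] and its sum is unchanged. Otherwise it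
   excludes [i], and by maximality of [x_i] each of its entries already reaches its target; the one
   at [j] still does after losing [e]. *)
- move=> k; have [xki|xki] := boolP (x 0 k <= x 0 i).
    apply: le_trans (lexY k) _.
    have xkj : (x 0 k <= x 0 j) && (j != i) by rewrite (le_trans xki) //= eq_sym.
    rewrite [leLHS](bigD1 i) //= [leRHS](bigD1 i) //= (bigD1 j) //=.
    rewrite [X in _ <= _ + X](bigD1 j) //= !DY !eqxx (eq_sym j i) (negPf nij).
    rewrite [X in _ <= _ + (_ + X)](eq_bigr (fun l => Y l l)); last first.
      by move=> l /andP[/andP[_ /negPf li] /negPf lj]; rewrite DY li lj.
    by rewrite !addrA (addrAC _ e) addrK.
  apply: ler_sum => l xkl; rewrite DY.
  have [li|_] := eqVneq l i; first by rewrite -li xkl in xki.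
  have [->|_] := eqVneq l j; first by rewrite lerBrDr addrC -lerBrDr.
  rewrite real_leNgt //; apply: contra xki => Yl.
  exact: le_trans xkl (maxi l Yl).
exists (W2 *m W1); first exact: mul_unitarymx.
by move=> k; have := leW k; rewrite /Y1 trmxC_mul !mulmxA.
Qed.
End SchurHorn.

(** * Roots of unity and pinching to the diagonal *)

Section Pinching.
Variables (C : numClosedFieldType) (d : nat).
Implicit Types (Y W : 'M[C]_d).

(** [X^n - 1] is separable, so it has [n] distinct roots; that many [n]-th roots of unity in a field
    include a primitive one. *)
Lemma exists_prim_root n : (0 < n)%N -> exists z : C, n.-primitive_root z.
Proof.
move=> n0; have [rs /= Drs] := closed_field_poly_normal ('X^n - 1 : {poly C}).
have szp := size_XnsubC (1 : C) n0.
rewrite (monicP (monicXnsubC 1 n0)) scale1r in Drs.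
have : has n.-primitive_root rs; last by case/hasP=> z _ prim_z; exists z.
apply: has_prim_root => //.
- by apply/allP=> z z_rs; rewrite /root_of_unity Drs root_prod_XsubC.
- by rewrite -separable_prod_XsubC -Drs separable_Xn_sub_1 ?pnatr_eq0 -?lt0n.
- by rewrite -ltnS -(size_prod_XsubC _ id) -Drs szp.
Qed.

Lemma prim_root_norm n (z : C) : (0 < n)%N -> n.-primitive_root z -> `|z| = 1.
Proof.
move=> n0 /prim_expr_order zn; apply/eqP.
by rewrite -(@pexpr_eq1 _ _ n) // -normrX zn normr1.
Qed.

Lemma prim_root_sum n (z : C) k : n.-primitive_root z -> (0 < k < n)%N ->
  \sum_(m < n) (z ^+ k) ^+ m = 0.
Proof.
move=> pz /andP[k0 kn]; have zk1 : z ^+ k - 1 != 0.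
  by rewrite subr_eq0 -(prim_order_dvd pz) gtnNdvd.
apply: (mulfI zk1); rewrite mulr0 -subrX1 -exprM mulnC exprM.
by rewrite (prim_expr_order pz) expr1n subrr.
Qed.

(** Conjugating by the [m]-th power of [diag(1, z, ..., z^(d-1))] multiplies entry [(k, l)] by the
    [m]-th power of [z^k (z^l)^*]. Summed over [m], these form a geometric sum that vanishes unless
    [k = l]. *)
Lemma pinching Y : (0 < d)%N -> exists2 V : 'I_d -> 'M[C]_d,
  (forall i, V i \is unitarymx) &
  \sum_i V i *m Y *m (V i)^t* = d%:R *: diag_mx (\row_i Y i i).
Proof.
move=> d0; have [z pz] := exists_prim_root d0.
have z1 := prim_root_norm d0 pz.
have zz m : z ^+ m * (z ^+ m)^* = 1 by rewrite -normCK normrX z1 !expr1n.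
pose V (m : 'I_d) : 'M[C]_d := diag_mx (\row_k (z ^+ (k * m))).
have VC m : (V m)^t* = diag_mx (\row_k (z ^+ (k * m))^*).
  by rewrite tr_diag_mx map_diag_mx; congr diag_mx; apply/rowP=> k; rewrite !mxE.
exists V => [m|].
  apply/unitarymxP; rewrite VC mulmx_diag; apply/matrixP=> k l.
  by rewrite !mxE zz.
apply/matrixP=> k l; rewrite summxE !mxE.
rewrite (eq_bigr (fun m : 'I_d => Y k l * (z ^+ k * (z ^+ l)^*) ^+ m)); last first.
  move=> m _; rewrite VC mul_mx_diag mul_diag_mx !mxE exprMn -rmorphXn /= -!exprM.
  by rewrite mulrAC mulrC.
rewrite -mulr_sumr; have [<-|kl] := eqVneq k l.
  under eq_bigr do rewrite zz expr1n.
  by rewrite sumr_const card_ord mulrC.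
have [lk|kl'|/val_inj/eqP] := ltngtP l k; last by rewrite eq_sym (negPf kl).
  have -> : z ^+ k * (z ^+ l)^* = z ^+ (k - l).
    by rewrite -{1}(subnK (ltnW lk)) exprD -mulrA zz mulr1.
  rewrite (prim_root_sum pz) ?subn_gt0 ?lk ?(leq_ltn_trans (leq_subr _ _)) //.
  by rewrite !mulr0.
have -> : z ^+ k * (z ^+ l)^* = (z ^+ (l - k))^*.
  rewrite -{1}(subnK (ltnW kl')) exprD rmorphM /= mulrCA.
  by rewrite zz mulr1.
under eq_bigr do rewrite -rmorphXn.
rewrite -rmorph_sum /= (prim_root_sum pz) ?conjC0 ?mulr0 //.
by rewrite subn_gt0 kl' (leq_ltn_trans (leq_subr _ _)).
Qed.

End Pinching.

(** * Averages of unitary conjugates, and the two moduli *)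

Section Averages.
Variables (C : numClosedFieldType) (d : nat).
Implicit Types (A B X W : 'M[C]_d).

Lemma psdmx_average_ge A B X : (0 < d)%N -> psdmx A -> psdmx B -> psdmx X ->
  A *m A + B *m B = X *m X ->
  exists2 V : 'I_d -> 'M[C]_d, (forall i, V i \is unitarymx) &
    loewner_le X (d%:R^-1 *: \sum_i V i *m (A + B) *m (V i)^t*).
Proof.
move=> d0 pA pB pX eABX.
have U := spectral_unitarymx X; have eX := herm_spectral pX.1.
have x0 i := spectral_diag_ge0 i pX.
set W := spectralmx X in U eX; set x := spectral_diag X in eX x0.
have sq M : W *m (M *m M) *m W^t* = (W *m M *m W^t*) *m (W *m M *m W^t*).
  by rewrite !mulmxA -[W *m M *m _ *m W]mulmxA (unitarymxC U) mulmx1.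
have pA' := psdmx_conjC W pA; have pB' := psdmx_conjC W pB.
have e : (W *m A *m W^t*) *m (W *m A *m W^t*) +
    (W *m B *m W^t*) *m (W *m B *m W^t*) = diag_mx x *m diag_mx x.
  by rewrite -eX -!sq -mulmxDl -mulmxDr eABX.
have hY := (psdmxD pA' pB').1.
have xR i : x 0 i \is Num.real by rewrite ger0_real.
have [T UT leT] := schur_horn_ge hY xR (fun k => level_set_sqrD k pA' pB' x0 e).
have [V UV eV] := pinching (T *m (W *m A *m W^t* + W *m B *m W^t*) *m T^t*) d0.
have Uc (M : 'M[C]_d) : M \is unitarymx -> M^t* \is unitarymx.
  by move=> UM; apply/unitarymxP; rewrite trmxCK; exact: unitarymxC.
(* Pass to an eigenbasis of [X] by [W], arrange the diagonal by [T], pinch by [V i], and return by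
   [W^*]. *)
exists (fun i => W^t* *m (V i *m T *m W)) => [i|].
  by rewrite !mul_unitarymx ?Uc.
apply: (psdmx_unitary_conj U).
rewrite mulmxBr mulmxBl eX -scalemxAr -scalemxAl mulmx_sumr mulmx_suml.
rewrite (eq_bigr (fun i => V i *m (T *m (W *m A *m W^t* + W *m B *m W^t*) *m T^t*)
  *m (V i)^t*)) => [|i _]; last first.
  rewrite !trmxC_mul trmxCK !mulmxA (unitarymxP U) mul1mx.
  rewrite -[_ *m W *m W^t*]mulmxA (unitarymxP U) mulmx1.
  by rewrite -mulmxDl -mulmxDr !mulmxA.
rewrite eV scalerA mulVf ?pnatr_eq0 -?lt0n // scale1r -linearB /=.
by apply: psdmx_diag => i; rewrite !mxE subr_ge0 (le_trans (leT i)) // mxE.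
Qed.

Lemma sqrtmx_mul A : psdmx A -> sqrtmx A *m sqrtmx A = A.
Proof. by move/sqrtmxK; rewrite expr2. Qed.

Lemma psdmx_absmx (Z : 'M[C]_d) : psdmx (absmx Z).
Proof. exact: psdmx_sqrtmx (psdmx_gram Z). Qed.

Lemma psdmx_qsymabsmx (Z : 'M[C]_d) : psdmx (qsymabsmx Z).
Proof.
apply/psdmx_sqrtmx/psdmxZ; first by rewrite invr_ge0 ler0n.
by apply: psdmxD; rewrite sqrtmxK; exact: psdmx_gram.
Qed.

Lemma qsymabsmx_mul (Z : 'M[C]_d) : 2 *: (qsymabsmx Z *m qsymabsmx Z) =
  absmx Z *m absmx Z + absmx (Z^t*) *m absmx (Z^t*).
Proof.
rewrite sqrtmx_mul.
  by rewrite scalerA mulfV ?pnatr_eq0 // scale1r !expr2.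
apply/psdmxZ; first by rewrite invr_ge0 ler0n.
by apply: psdmxD; rewrite sqrtmxK; exact: psdmx_gram.
Qed.

(** The matrix [X = s |Z|_qsym] satisfies [X^2 = |Z|^2 + |Z^*|^2]. After division by [s], the
    identity [s^-1 = s / 2] turns [|Z| + |Z^*|] into [s |Z|_sym]. *)
Lemma qsymabsmx_le_average (s : C) (Z : 'M[C]_d) :
  (0 < d)%N -> 0 < s -> s * s = 2 ->
  exists V : 'I_d -> 'M[C]_d, (forall i, V i \is unitarymx) /\
    loewner_le (qsymabsmx Z)
      ((s / d%:R) *: \sum_(i < d) V i *m symabsmx Z *m (V i)^t*).
Proof.
move=> d0 s0 s2; have [|V UV leV] := psdmx_average_ge d0 (psdmx_absmx Z)
    (psdmx_absmx (Z^t*)) (psdmxZ (ltW s0) (psdmx_qsymabsmx Z)).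
  by rewrite -scalemxAr -scalemxAl scalerA s2 qsymabsmx_mul.
have sn0 : s != 0 by rewrite gt_eqF.
exists V; split => //; have sV0 : 0 <= s^-1 by rewrite invr_ge0 ltW.
have eS : \sum_i V i *m symabsmx Z *m (V i)^t*
    = 2^-1 *: \sum_i V i *m (absmx Z + absmx (Z^t*)) *m (V i)^t*.
  by rewrite scaler_sumr; apply: eq_bigr => i _; rewrite -scalemxAr -scalemxAl.
have es : s^-1 / d%:R = s / d%:R / 2.
  rewrite mulrAC; congr (_ / _); apply: (mulfI sn0).
  by rewrite mulfV // mulrA s2 mulfV ?pnatr_eq0.
rewrite eS [in X in loewner_le _ X]scalerA -es /loewner_le.
have := psdmxZ sV0 leV; rewrite scalerBr.
rewrite [in X in psdmx (X - _)]scalerA [in X in psdmx (_ - X)]scalerA.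
by rewrite mulVf // scale1r.
Qed.

(* For [Z = E_01], both moduli are diagonal projections with sum 1. *)
Lemma average_delta_bound (c s : C) (V : 'I_2 -> 'M[C]_2) :
  0 < s -> s * s = 2 ->
  (forall i, V i \is unitarymx) ->
  loewner_le (qsymabsmx (delta_mx 0 1))
    ((c / 2%:R) *: \sum_(i < 2) V i *m symabsmx (delta_mx 0 1) *m (V i)^t*) ->
  s <= c.
Proof.
move=> s0 s2 UV; have sn0 : s != 0 by rewrite gt_eqF.
have absE (i : 'I_2) : sqrtmx (delta_mx i i : 'M[C]_2) = delta_mx i i.
  apply: sqrtmx_unique; last by rewrite expr2; exact: mul_delta_mx.
  have := psdmx_gram (delta_mx i i : 'M[C]_2).
  by rewrite trmx_delta map_delta_mx mul_delta_mx.
have sumE : delta_mx 1 1 + delta_mx 0 0 = 1%:M :> 'M[C]_2.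
  by rewrite addrC mx1_sum_delta big_ord_recl big_ord1; congr (_ + delta_mx _ _);
    apply: val_inj.
rewrite /qsymabsmx /symabsmx /absmx trmxCK trmx_delta map_delta_mx.
rewrite !mul_delta_mx !absE !expr2 -![delta_mx _ _ * _]/(_ *m _) !mul_delta_mx sumE.
have -> : sqrtmx (2^-1 *: 1%:M) = s^-1 *: 1%:M :> 'M[C]_2.
  apply: sqrtmx_unique.
    apply: psdmxZ; first by rewrite invr_ge0 ltW.
    by have := psdmx_gram (1%:M : 'M[C]_2); rewrite trmx1 map_mx1 mulmx1.
  by rewrite expr2 -[_ * _]/(_ *m _) -scalemxAr -scalemxAl mulmx1 scalerA -invfM s2.
(* The symmetric modulus is scalar, so conjugation fixes it and the inequality reduces to
   [s^-1 <= c / 2]. *)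
rewrite (eq_bigr (fun=> 2^-1 *: 1%:M)) => [|i _]; last first.
  by rewrite -scalemxAr -scalemxAl mulmx1 (unitarymxP (UV i)).
rewrite sumr_const card_ord -scaler_nat scalerA mulfV ?pnatr_eq0 // scale1r.
rewrite /loewner_le -scalerBl => /(psdmx_diag_ge0 0); rewrite !mxE mulr1 subr_ge0.
by rewrite ler_pdivlMr ?ltr0n // -s2 mulrA mulVf // mul1r.
Qed.

End Averages.

(** * The inequality and its sharpness over the complex numbers *)

Local Open Scope complex_scope.

Theorem corollary2p12 (R : realType) :
  (forall (d : nat) (Z : 'M[R[i]]_d), (1 <= d)%N ->
     exists V : 'I_d -> 'M[R[i]]_d,
       (forall i, V i \is unitarymx) /\
       loewner_le (qsymabsmx Z)
         ((Num.sqrt 2 / d%:R)%:C *: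
            \sum_(i < d) V i *m symabsmx Z *m (V i)^t*))
  /\
  ~ (exists c : R, c < Num.sqrt 2 /\
       forall (d : nat) (Z : 'M[R[i]]_d), (1 <= d)%N ->
         exists V : 'I_d -> 'M[R[i]]_d,
           (forall i, V i \is unitarymx) /\
           loewner_le (qsymabsmx Z)
             ((c / d%:R)%:C *:
                \sum_(i < d) V i *m symabsmx Z *m (V i)^t*)).
Proof.
have s0 : 0 < (Num.sqrt 2)%:C :> R[i] by rewrite ltcR sqrtr_gt0 ltr0n.
have s2 : (Num.sqrt 2)%:C * (Num.sqrt 2)%:C = 2 :> R[i].
  by rewrite -rmorphM /= -expr2 sqr_sqrtr ?ler0n // rmorph_nat.
have divE (c : R) d : (c / d%:R)%:C = c%:C / d%:R :> R[i].
  by rewrite rmorphM /= fmorphV /= rmorph_nat.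
(* Sharpness is already visible for [d = 2] and the nilpotent matrix unit [E_01]. *)
split=> [d Z d0|[c [c_lt /(_ 2 (delta_mx 0 1) isT) [V [UV leV]]]]].
  by rewrite divE; exact: qsymabsmx_le_average.
rewrite divE in leV; have := average_delta_bound s0 s2 UV leV.
by rewrite lecR leNgt c_lt.
Qed.
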